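(* Let $M\in\mathbb{C}^{m\times m}$, let $U_0,V_0\in\mathbb{C}^{m\times m}$ and $\Sigma_0=\mathrm{diag}(\sigma_1,\dots,\sigma_m)$ with $\sigma_1\ge\cdots\ge\sigma_m\ge0$, let $\Delta_0=U_0^*MV_0-\Sigma_0$, $K=K(\Sigma_0)$, and suppose that $$e:=\max\Big(\frac{K^{a-1}\|\Delta_0\|}{u_0},\ \frac{K^a}{u_0}\|E_m(U_0)\|,\ \frac{K^a}{u_0}\|E_m(V_0)\|\Big)^{1/a}\le1 .$$ Then the deflation algorithm described in the context, run on $(U_0,V_0,\Sigma_0)$, computes a deflation of $(U_0,V_0,\Sigma_0)$.
   Context: Norm: $\|A\|=\max(\|A\|_1,\|A^*\|_1)$ with $\|A\|_1=\max_i\sum_j|A_{i,j}|$; $E_m(W)=W^*W-I_m$; $K(\Sigma)=\max(1,\max_i\sigma_i)$. The constants $a,u_0$ depend on a fixed integer $p\ge1$: $(a,u_0)=(2,0.0289)$ for $p=1$, $(4/3,0.046)$ for $p=2$, $(4/3,0.0297)$ for $p\ge3$. For a diagonal matrix with diagonal entries $\tau_1,\dots,\tau_q$ put $\kappa=\max\Big(1,\max_{1\le i<j\le q}\big(\frac1{|\tau_i-\tau_j|}+\frac1{|\tau_i+\tau_j|}\big)\Big)$ (so $\kappa=1$ if $q=1$), and for $i\neq j$ let $\kappa_{i,j}=\max\Big(1,\frac1{|\sigma_i-\sigma_j|}+\frac1{|\sigma_i+\sigma_j|}\Big)$; if a denominator vanishes the value is $+\infty$, and then ''$\kappa e\le1$''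 is regarded as false and ''$\kappa e>1$'' as true. Deflation. For a list $k$ of $q$ distinct indices in $\{1,\dots,m\}$ let $\Sigma_{0,q}$ be the diagonal matrix of the $\sigma_i$, $i\in k$, and $U_{0,q}=U_0(:,k)$, $V_{0,q}=V_0(:,k)$ the submatrices of columns indexed by $k$. The index of deflation of $(U_0,V_0,\Sigma_0)$ is the maximal $q$ for which $\Sigma_0$ can be rewritten (by reordering its diagonal entries) as a block diagonal matrix with a first diagonal block $\Sigma_{0,q}$ of size $q$ satisfying $\kappa(\Sigma_{0,q})\,e\le1$. If $q$ is the index of deflation and $\Sigma_{0,q}$ is such a block, the corresponding $(U_{0,q},V_{0,q},\Sigma_{0,q})$ is called a deflation of $(U_0,V_0,\Sigma_0)$. Algorithm. Start with the list $k=[1]$ and $i=1$. While $i\le m$: set $j=1$; while $i+j\le m$ and $\kappa_{i,i+j}\,e>1$, increase $j$ by $1$; if $i+j\le m$ and $\kappa_{i,i+j}\,e\le1$, append $i+j$ to $k$; set $i=i+j$. At the end let $q$ be the length of $k$ and output $(U_0(:,k),V_0(:,k),\Sigma_{0,q})$ with $\Sigma_{0,q}$ the diagonal matrix of the $\sigma_i$, $i\in k$. *)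

(* Defs.v *)
(* MathComp + MathComp-Analysis; complex numbers are [R[i]] over [R : realType]. *)
From HB Require Import structures.
From mathcomp Require Import all_boot all_order all_algebra all_fingroup.
From mathcomp Require Import all_classical all_reals all_analysis.
From mathcomp Require Import complex.

Set Implicit Arguments.
Unset Strict Implicit.
Unset Printing Implicit Defensive.

Import Order.TTheory GRing.Theory Num.Theory.
Local Open Scope ring_scope.
Local Open Scope complex_scope.

(* Matrix norms.  The default value 0 of the iterated maximum is harmless, all
   row sums being nonnegative. *)
Definition norm1 (R : realType) (m n : nat) (A : 'M[R[i]]_(m, n)) : R :=
  \big[Num.max/0]_(i < m) \sum_(j < n) Normc.normc (A i j).

Definition adjoint (R : realType) (m n : nat) (A : 'M[R[i]]_(m, n)) :
    'M[R[i]]_(n, m) :=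
  map_mx (@conjc R) A^T.

Definition mxnorm (R : realType) (m n : nat) (A : 'M[R[i]]_(m, n)) : R :=
  Num.max (norm1 A) (norm1 (adjoint A)).

Definition E_ (R : realType) (l m : nat) (W : 'M[R[i]]_(l, m)) : 'M[R[i]]_m :=
  adjoint W *m W - 1%:M.

Definition diagC (R : realType) (m : nat) (sigma : 'rV[R]_m) : 'M[R[i]]_m :=
  map_mx (real_complex R) (diag_mx sigma).

Definition Kconst (R : realType) (m : nat) (sigma : 'rV[R]_m) : R :=
  \big[Num.max/1]_(i < m) sigma 0 i.

Definition a_ (R : realType) (p : nat) : R :=
  if p == 1%N then 2 else 4 / 3.

Definition u0_ (R : realType) (p : nat) : R :=
  if p == 1%N then 289 / 10000
  else if p == 2%N then 46 / 1000 else 297 / 10000.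

Definition defl_e (R : realType) (p m : nat) (M U0 V0 : 'M[R[i]]_m)
    (sigma : 'rV[R]_m) : R :=
  let a := a_ R p in
  let u0 := u0_ R p in
  let K := Kconst sigma in
  let Delta0 := adjoint U0 *m M *m V0 - diagC sigma in
  (Num.max (powR K (a - 1) * mxnorm Delta0 / u0)
    (Num.max (powR K a / u0 * mxnorm (E_ U0))
             (powR K a / u0 * mxnorm (E_ V0)))) `^ (1 / a).

Section Kappa.
Local Open Scope ereal_scope.

(* In [\bar R] the inverse of 0 is +oo. *)
Definition gap (R : realType) (s t : R) : \bar R :=
  (`|s - t|%R%:E)^-1 + (`|s + t|%R%:E)^-1.

Definition kappa2 (R : realType) (s t : R) : \bar R := maxe 1 (gap s t).

Definition kappa (R : realType) (q : nat) (T : 'M[R]_q) : \bar R :=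
  \big[maxe/1]_(i < q) \big[maxe/1]_(j < q | (i < j)%N) gap (T i i) (T j j).

(* "kappa e <= 1" and "kappa e > 1".  The case kappa = +oo is separated because
   MathComp-Analysis sets +oo * 0 = 0, whereas here +oo counts as too large even
   when e = 0. *)
Definition kappa_le1 (R : realType) (k : \bar R) (e : R) : bool :=
  (k != +oo) && (k * e%:E <= 1).

Definition kappa_gt1 (R : realType) (k : \bar R) (e : R) : bool :=
  (k == +oo) || (1 < k * e%:E).

End Kappa.

Definition Sigma_sub (R : realType) (m q : nat) (sigma : 'rV[R]_m)
    (k : q.-tuple 'I_m) : 'M[R]_q :=
  diag_mx (colsub (tnth k) sigma).

Definition col_sub (R : realType) (m q : nat) (U : 'M[R[i]]_m)
    (k : q.-tuple 'I_m) : 'M[R[i]]_(m, q) :=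
  colsub (tnth k) U.

(* Some reordering [s] of the diagonal entries turns [diag_mx sigma] into a block
   diagonal matrix whose first block, of size [q], is made of the entries with
   indices in the list [k]. *)
Definition leading_block (R : realType) (m q : nat) (sigma : 'rV[R]_m)
    (k : q.-tuple 'I_m) : Prop :=
  exists (s : 'S_m) (r : nat) (mqr : m = (q + r)%N) (B : 'M[R]_r),
    (forall i : 'I_q, tnth k i = s (cast_ord (esym mqr) (lshift r i))) /\
    castmx (mqr, mqr) (diag_mx (col_perm s sigma)) =
      block_mx (Sigma_sub sigma k) 0 0 B.

Definition deflation_list (R : realType) (m q : nat) (sigma : 'rV[R]_m) (e : R)
    (k : q.-tuple 'I_m) : Prop :=
  [/\ uniq k, leading_block sigma k & kappa_le1 (kappa (Sigma_sub sigma k)) e].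

Definition is_deflation_index (R : realType) (m : nat) (sigma : 'rV[R]_m)
    (e : R) (q : nat) : Prop :=
  (exists k : q.-tuple 'I_m, deflation_list sigma e k) /\
  (forall (q' : nat) (k : q'.-tuple 'I_m), deflation_list sigma e k -> (q' <= q)%N).

Definition is_deflation (R : realType) (m : nat) (U0 V0 : 'M[R[i]]_m)
    (sigma : 'rV[R]_m) (e : R) (q : nat)
    (Uq Vq : 'M[R[i]]_(m, q)) (Sq : 'M[R]_q) : Prop :=
  is_deflation_index sigma e q /\
  exists k : q.-tuple 'I_m,
    [/\ deflation_list sigma e k,
        Uq = col_sub U0 k, Vq = col_sub V0 k & Sq = Sigma_sub sigma k].

(* [while_loop c b s s']: "while c do b", started in state [s], terminates in
   state [s']. *)
Inductive while_loop (S : Type) (c : S -> bool) (b : S -> S -> Prop) :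
    S -> S -> Prop :=
| while_exit s : ~~ c s -> while_loop c b s s
| while_iter s1 s2 s3 :
    c s1 -> b s1 s2 -> while_loop c b s2 s3 -> while_loop c b s1 s3.

(* Indices are shifted by one: they range over 0, ..., m - 1 with m = n.+1, so
   the tests "i <= m" and "i + j <= m" read [i < m] and [i + j < m], and the
   initial values k = [1], i = 1 become k = [0], i = 0. *)
Section Algorithm.
Variables (R : realType) (n : nat) (sigma : 'rV[R]_n.+1) (e : R).

(* Only used for indices below n.+1, where [inord] is the identity. *)
Definition kappa_at (i j : nat) : \bar R :=
  kappa2 (sigma 0 (inord i)) (sigma 0 (inord j)).

Definition inner_loop (i : nat) : nat -> nat -> Prop :=
  while_loop (fun j => (i + j < n.+1)%N && kappa_gt1 (kappa_at i (i + j)) e)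
             (fun j j' => j' = j.+1).

Definition outer_body (st st' : nat * seq 'I_n.+1) : Prop :=
  let: (i, k) := st in
  exists2 j, inner_loop i 1 j &
    st' = ((i + j)%N,
           if (i + j < n.+1)%N && kappa_le1 (kappa_at i (i + j)) e
           then rcons k (inord (i + j)) else k).

Definition outer_loop : nat * seq 'I_n.+1 -> nat * seq 'I_n.+1 -> Prop :=
  while_loop (fun st => st.1 < n.+1)%N outer_body.

(* [deflation_algorithm U0 V0 Uq Vq Sq]: the algorithm terminates and outputs
   [(Uq, Vq, Sq)]. *)
Definition deflation_algorithm (U0 V0 : 'M[R[i]]_n.+1) (q : nat)
    (Uq Vq : 'M[R[i]]_(n.+1, q)) (Sq : 'M[R]_q) : Prop :=
  exists (i : nat) (k : q.-tuple 'I_n.+1),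
    [/\ outer_loop (0%N, [:: ord0]) (i, tval k),
        Uq = col_sub U0 k, Vq = col_sub V0 k & Sq = Sigma_sub sigma k].

End Algorithm.

(* Main.v *)
Require Import Defs.
From mathcomp Require Import all_boot all_order all_algebra all_fingroup.
From mathcomp Require Import all_classical all_reals all_analysis.
From mathcomp Require Import complex.
From mathcomp Require Import zify ring lra.

(** For [s >= t >= 0] the quantity [1/|s - t| + 1/|s + t|] decreases when [s]
    grows or [t] shrinks.  Hence compatibility ([kappa_(i,j) e <= 1]) of a pair
    [i < j] is preserved when [i] is decreased, so that each index appended by
    the algorithm is compatible with all the earlier ones.  The selected indices cut
    the index set into blocks, each reaching up to the first index compatible
    with its initial element; two indices of the same block are never
    compatible, so no admissible list is longer than the output. *)

Set Implicit Arguments.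
Unset Strict Implicit.
Unset Printing Implicit Defensive.

Import Order.TTheory GRing.Theory Num.Theory.
Local Open Scope ring_scope.
Local Open Scope complex_scope.

(** * Monotonicity of the gaps and of their test against [e] *)

Section Kappa.
Variable R : realType.
Implicit Types (s t e : R) (x y : \bar R).

Lemma kappa_gt1N x e : kappa_gt1 x e = ~~ kappa_le1 x e.
Proof. by rewrite /kappa_gt1 /kappa_le1 negb_and negbK -ltNge. Qed.

Lemma kappa_le1_anti x y e :
  0 <= e -> (x <= y)%E -> kappa_le1 y e -> kappa_le1 x e.
Proof.
move=> e0 xy /andP[yoo ye]; apply/andP; split.
  by apply: contra_neq yoo => xoo; apply/eqP; rewrite -leye_eq -xoo.
by apply: le_trans ye; apply: lee_wpmul2r; rewrite ?lee_fin.
Qed.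

Lemma kappa_le1_max x y e :
  0 <= e -> kappa_le1 (maxe x y) e = kappa_le1 x e && kappa_le1 y e.
Proof.
move=> e0; apply/idP/andP => [h|[hx hy]]; last by rewrite maxEle; case: ifP.
by split; apply: kappa_le1_anti h => //; rewrite le_max lexx ?orbT.
Qed.

(** Every use of [e <= 1] comes down to this: the base value 1 of the maxima passes the test, so
    only the gaps decide. *)
Lemma kappa_le1_1 e : e <= 1 -> kappa_le1 1%E e.
Proof. by move=> e1; rewrite /kappa_le1 mul1e lee_fin e1. Qed.

Lemma kappa_le1_kappa2 s t e :
  0 <= e -> e <= 1 -> kappa_le1 (kappa2 s t) e = kappa_le1 (gap s t) e.
Proof. by move=> e0 e1; rewrite /kappa2 kappa_le1_max // kappa_le1_1. Qed.

Lemma gapC s t : gap s t = gap t s.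
Proof. by rewrite /gap distrC (addrC s). Qed.

(* [1/(s-t) + 1/(s+t) = 2 s / (s^2 - t^2)], which increases with [t]. *)
Lemma gap_anti s t s' t' :
  0 <= t' -> t' <= t -> t <= s -> s <= s' -> (gap s' t' <= gap s t)%E.
Proof.
move=> t0 tt ts ss.
(* If [s = t], the first summand of [gap s t] is the inverse of 0, so the right-hand side is
   [+oo]. *)
have [st|st] := eqVneq s t.
  rewrite [leRHS](_ : _ = +oo%E) ?leey // /gap st subrr normr0 inve0.
  by rewrite addye // -ltNye (lt_le_trans ltNy0) // inve_ge0 lee_fin.
have lts : t < s by rewrite lt_neqAle eq_sym st.
have gapE (u v : R) : v < u -> 0 <= v -> gap u v = ((u - v)^-1 + (u + v)^-1)%:E.
  move=> vu v0; have h1 : 0 < u - v by lra.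
  have h2 : 0 < u + v by lra.
  by rewrite /gap !gtr0_norm // !inver !gt_eqF.
have sumE (u v : R) : v < u -> 0 <= v ->
    (u - v)^-1 + (u + v)^-1 = 2 * u / ((u - v) * (u + v)).
  move=> vu v0; have h1 : u - v != 0 by apply: lt0r_neq0; lra.
  have h2 : u + v != 0 by apply: lt0r_neq0; lra.
  by field; rewrite h1 h2.
rewrite !gapE ?lee_fin; try lra.
(* Passing from [s'] to [s] raises both inverses separately. Passing from [t'] to [t] lowers the
   second one, so that step uses the closed form, whose numerator [2 * s] is fixed. *)
apply: (@le_trans _ _ ((s - t')^-1 + (s + t')^-1)).
  by apply: lerD; rewrite lef_pV2 ?posrE; lra.
rewrite !sumE; try lra.
rewrite ler_wpM2l //; first lra.
by rewrite lef_pV2 ?posrE; nra.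
Qed.

Lemma kappa_le1P (q : nat) (T : 'M[R]_q) e : 0 <= e -> e <= 1 ->
  reflect (forall i j : 'I_q, (i < j)%N -> kappa_le1 (gap (T i i) (T j j)) e)
          (kappa_le1 (kappa T) e).
Proof.
move=> e0 e1; apply: (iffP idP) => [h i j ij|h].
  apply: kappa_le1_anti h => //; rewrite /kappa.
  by apply: le_trans (le_bigmax _ _ i); apply: le_bigmax_cond.
have hmax x y : kappa_le1 x e -> kappa_le1 y e -> kappa_le1 (maxe x y) e.
  by move=> hx hy; rewrite kappa_le1_max // hx.
rewrite /kappa; elim/big_ind: _ => [|//|i _]; first exact: kappa_le1_1.
elim/big_ind: _ => [|//|j ij]; [exact: kappa_le1_1 | exact: h].
Qed.

End Kappa.

(** * Moving the listed diagonal entries to the front *)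

Lemma uniq_tuple_perm (m q r : nat) (mqr : m = (q + r)%N) (k : q.-tuple 'I_m) :
  uniq k -> exists s : 'S_m,
    forall i : 'I_q, tnth k i = s (cast_ord (esym mqr) (lshift r i)).
Proof.
case: m => [|m] in mqr k *.
  by move=> _; exists 1%g => i; have := ltn_ord (tnth k i); rewrite ltn0.
(* The list [k] followed by its complement enumerates all indices once; reading off its entries is
   the permutation. *)
move=> uk; pose l := tval k ++ [seq x <- enum 'I_m.+1 | x \notin k].
have ul : uniq l.
  rewrite cat_uniq uk filter_uniq ?enum_uniq // andbT.
  by apply/hasPn => x; rewrite mem_filter => /andP[].
have sl : size l = m.+1.
  rewrite -[RHS]card_ord -(card_uniqP ul); apply: eq_card => x.
  by rewrite mem_cat mem_filter mem_enum andbT orbN.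
have inj : injective (fun i : 'I_m.+1 => nth ord0 l i).
  by move=> i j /eqP; rewrite nth_uniq ?sl // => /eqP/val_inj.
exists (perm inj) => i; rewrite permE /= nth_cat size_tuple ltn_ord.
exact: tnth_nth.
Qed.

(** A permuted diagonal matrix is still diagonal, so its off-diagonal blocks vanish, and [B] is read
    off as the lower right block. *)
Lemma uniq_leading_block (R : realType) (m q : nat) (sigma : 'rV[R]_m)
  (k : q.-tuple 'I_m) : uniq k -> leading_block sigma k.
Proof.
move=> uk; have mqr : m = (q + (m - q))%N.
  rewrite subnKC // -{1}(size_tuple k) -(card_uniqP uk) -[leqRHS]card_ord.
  exact: max_card.
have [s sE] := uniq_tuple_perm mqr uk.
exists s, (m - q)%N, mqr.
set A := castmx _ _; exists (drsubmx A); split=> //.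
have AE i j : A i j = (sigma 0 (s (cast_ord (esym mqr) i))) *+ (i == j).
  by rewrite castmxE !mxE.
rewrite -[LHS]submxK; congr block_mx; apply/matrixP => i j.
- by rewrite !mxE AE sE.
- by rewrite !mxE AE eq_lrshift.
- by rewrite !mxE AE eq_rlshift.
Qed.

(** * Invariants and termination of while loops *)

Section WhileLoop.
Variables (S : Type) (c : S -> bool) (b : S -> S -> Prop).

Lemma while_loop_inv (P : S -> Prop) s s' :
  (forall s1 s2, c s1 -> b s1 s2 -> P s1 -> P s2) ->
  while_loop c b s s' -> P s -> P s' /\ ~~ c s'.
Proof. by move=> hP; elim=> [|s1 s2 s3 c1 b12 _ ih /(hP _ _ c1 b12)/ih]. Qed.

Lemma while_loop_term (mu : S -> nat) s :
  (forall s1, c s1 -> exists2 s2, b s1 s2 & (mu s2 < mu s1)%N) ->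
  exists s', while_loop c b s s'.
Proof.
move=> hb; have [N] := ubnP (mu s); elim: N s => // N ih s muN.
have [cs|ncs] := boolP (c s); last by exists s; apply: while_exit.
have [s2 bs lt2] := hb _ cs.
have [s3 h3] := ih s2 (leq_trans lt2 muN).
by exists s3; apply: while_iter h3.
Qed.

End WhileLoop.

(** * Correctness and maximality of the greedy selection *)

Section Greedy.
Variables (R : realType) (n : nat) (sigma : 'rV[R]_n.+1) (e : R).

Definition compatible (i j : nat) := kappa_le1 (kappa_at sigma i j) e.

(** The rejections form the loop invariant, vacuous at [j = 1]. On exit the guard fails, and within
    range this can only mean acceptance. *)
Lemma inner_loopP i j : inner_loop sigma e i 1 j ->
  [/\ (0 < j)%N, forall z, (i < z < i + j)%N -> ~~ compatible i z &
      (i + j < n.+1)%N -> compatible i (i + j)].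
Proof.
move=> h.
pose P j := (0 < j)%N /\ forall z, (i < z < i + j)%N -> ~~ compatible i z.
have step s s' : (i + s < n.+1)%N && kappa_gt1 (kappa_at sigma i (i + s)) e ->
    s' = s.+1 -> P s -> P s'.
  move=> /andP[_]; rewrite kappa_gt1N => sN -> [_ hs]; split=> // z iz.
  have [->//|zs] := eqVneq z (i + s)%N.
  by apply: hs; lia.
have P1 : P 1%N by split=> // z; lia.
have [[j0 hj]] := while_loop_inv step h P1.
by rewrite negb_and kappa_gt1N negbK => hx; split=> // ij; rewrite ij in hx.
Qed.

(** In both loops the distance to the end of the range decreases; in the outer one because the inner
    loop returns [j > 0]. *)
Lemma outer_loop_term st : exists st', outer_loop sigma e st st'.
Proof.
apply: (@while_loop_term _ _ _ (fun st => n.+1 - st.1)%N) => -[i k] /= ilt.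
have [j hj] : exists j, inner_loop sigma e i 1 j.
  apply: (@while_loop_term _ _ _ (fun j => n.+1 - (i + j))%N) => s /andP[si _].
  by exists s.+1 => //; lia.
have [j0 _ _] := inner_loopP hj.
by eexists; first (exists j; [exact: hj | reflexivity]); rewrite /=; lia.
Qed.

Hypothesis sigma_ge0 : forall i : 'I_n.+1, 0 <= sigma 0 i.
Hypothesis sigma_noninc :
  forall i j : 'I_n.+1, (i <= j)%N -> sigma 0 j <= sigma 0 i.
Hypotheses (e0 : 0 <= e) (e1 : e <= 1).

Lemma compatible_widen (i i' j : nat) : (i <= i' < j)%N -> (j < n.+1)%N ->
  compatible i' j -> compatible i j.
Proof.
move=> /andP[ii i'j] jn; rewrite /compatible /kappa_at !kappa_le1_kappa2 //.
by apply: kappa_le1_anti => //; apply: gap_anti => //; apply: sigma_noninc;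
  rewrite !inordK //; lia.
Qed.

Lemma compatible_ord (x y : 'I_n.+1) :
  compatible x y = kappa_le1 (gap (sigma 0 x) (sigma 0 y)) e.
Proof. by rewrite /compatible /kappa_at !inord_val kappa_le1_kappa2. Qed.

(* Every index [y <= i] lies in the block of some selected [g], that is, [y]
   comes before the first index that is compatible with [g]. *)
Definition greedy_state (st : nat * seq 'I_n.+1) : Prop :=
  [/\ pairwise (fun x y : 'I_n.+1 => (x < y)%N && compatible x y) st.2,
      forall x, x \in st.2 -> (x <= st.1)%N,
      (st.1 < n.+1)%N -> inord st.1 \in st.2 &
      forall y : 'I_n.+1, (y <= st.1)%N ->
        exists2 g : 'I_n.+1, g \in st.2 &
          (g <= y)%N /\ forall z, (g < z <= y)%N -> ~~ compatible g z].

Lemma outer_loopP i k : outer_loop sigma e (0%N, [:: ord0]) (i, k) ->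
  greedy_state (i, k) /\ (n < i)%N.
Proof.
move=> h; rewrite ltnNge.
apply: (while_loop_inv (P := greedy_state)) h _; last first.
  split=> //= [x|_|y]; first by rewrite inE => /eqP ->.
    by rewrite inE; apply/eqP/val_inj; rewrite /= inordK.
  rewrite leqn0 => /eqP y0; exists ord0; rewrite ?inE //; split=> // z.
  by rewrite y0 /=; lia.
move=> [{}i {}k] _ /= ilt [j /inner_loopP[j0 jbad jgood] ->] [/= kp kle ki cov].
have iE : (inord i : 'I_n.+1) = i :> nat by rewrite inordK.
(* Indices up to [i] keep their old block; those strictly between [i] and [i + j] were rejected
   against [i] and join its block. *)
have covlt l (y : 'I_n.+1) : {subset k <= l} -> (y < i + j)%N ->
    exists2 g : 'I_n.+1, g \in l &
      (g <= y)%N /\ forall z, (g < z <= y)%N -> ~~ compatible g z.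
  move=> kl yij; have [yi|iy] := leqP y i.
    by have [g gk hg] := cov y yi; exists g => //; apply: kl.
  exists (inord i); first exact/kl/ki.
  by rewrite iE; split=> [|z zy]; [lia | apply: jbad; lia].
(* Past the end nothing is appended and the last block absorbs the rest; within range [i + j] was
   accepted and starts a new block. *)
have [ij|ij] := ltnP (i + j) n.+1; last first.
  split=> //=; [by move=> x /kle; lia | lia |].
  by move=> y _; apply: covlt => //; have := ltn_ord y; lia.
move: (jgood ij) => gij; rewrite [kappa_le1 _ _]gij /=.
have ijE : (inord (i + j) : 'I_n.+1) = (i + j)%N :> nat by rewrite inordK.
split=> /=.
- rewrite pairwise_rcons kp andbT; apply/allP => x /kle xi.
  rewrite ijE; apply/andP; split; first by lia.
  by apply: compatible_widen gij => //; lia.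
- by move=> x; rewrite mem_rcons inE => /orP[/eqP ->|/kle]; [rewrite ijE | lia].
- by rewrite mem_rcons mem_head.
- move=> y; rewrite leq_eqVlt => /orP[/eqP yij|]; last first.
    by apply: covlt => x xk; rewrite mem_rcons inE xk orbT.
  exists y; last by split=> // z; lia.
  by rewrite mem_rcons inE; apply/orP; left; apply/eqP/val_inj; rewrite /= ijE.
Qed.

Lemma deflation_list_pairwise q (k : q.-tuple 'I_n.+1) :
  pairwise (fun x y : 'I_n.+1 => (x < y)%N && compatible x y) k ->
  deflation_list sigma e k.
Proof.
move=> kp.
have uk : uniq k.
  rewrite uniq_pairwise; apply: sub_pairwise kp => x y /andP[xy _].
  by rewrite /= -val_eqE neq_ltn xy.
split=> //; first exact: uniq_leading_block.
apply/kappa_le1P => // i j ij; rewrite !mxE !eqxx !mulr1n -compatible_ord.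
rewrite !(tnth_nth ord0).
have /(pairwiseP ord0)/(_ i j) := kp.
by rewrite !inE size_tuple => /(_ (ltn_ord i) (ltn_ord j) ij)/andP[].
Qed.

Lemma deflation_list_compatible q (k : q.-tuple 'I_n.+1) (x y : 'I_n.+1) :
  deflation_list sigma e k -> x \in k -> y \in k -> (x < y)%N -> compatible x y.
Proof.
move=> [uk _ /kappa_le1P kk] /tnthP[i ->] /tnthP[j ->] xy.
rewrite compatible_ord.
(* An arbitrary admissible list need not be increasing; the symmetry of [gap] handles reversed
   positions. *)
have [ij|ji|/val_inj ij] := ltngtP i j; last by rewrite ij ltnn in xy.
  by have := kk e0 e1 _ _ ij; rewrite !mxE !eqxx !mulr1n.
by have := kk e0 e1 _ _ ji; rewrite !mxE !eqxx !mulr1n gapC.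
Qed.

(* Two compatible indices lie in different blocks, so [k'] injects into [k]. *)
Lemma greedy_state_max i k q' (k' : q'.-tuple 'I_n.+1) :
  greedy_state (i, k) -> (n < i)%N -> deflation_list sigma e k' ->
  (q' <= size k)%N.
Proof.
move=> [_ _ _ /= cov] ni dk'.
have /boolp.choice[f hf] (y : 'I_n.+1) : exists g : 'I_n.+1,
    [/\ g \in k, (g <= y)%N & forall z, (g < z <= y)%N -> ~~ compatible g z].
  have [|g gk [gy hg]] := cov y; first by have := ltn_ord y; lia.
  by exists g.
have [uk' _ _] := dk'.
have flt (x y : 'I_n.+1) : x \in k' -> y \in k' -> (x < y)%N -> f x != f y.
  move=> xk yk xy; apply/eqP => fxy.
  have [_ fx _] := hf x; have [_ _ fy] := hf y.
  (* Since [f x <= x < y], compatibility of [x] with [y] widens to [f x] with [y], although [y] lies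
     in the block of [f x]. *)
  have /negP[] : ~~ compatible (f x) y.
    by rewrite fxy; apply: fy; rewrite -fxy; lia.
  apply: (@compatible_widen _ x) => //; first by rewrite fx.
  exact: deflation_list_compatible dk' _ _ _.
have inj : {in k' &, injective f}.
  move=> x y xk yk fxy; apply/val_inj; have [xy|yx|//] := ltngtP x y.
    by have := flt _ _ xk yk xy; rewrite fxy eqxx.
  by have := flt _ _ yk xk yx; rewrite fxy eqxx.
rewrite -(size_tuple k') -(size_map f); apply: uniq_leq_size.
  by rewrite map_inj_in_uniq.
by move=> _ /mapP[x _ ->]; have [] := hf x.
Qed.

End Greedy.

Theorem theorem11p10 (R : realType) (p : nat) (hp : (1 <= p)%N) (n : nat)
    (M U0 V0 : 'M[R[i]]_n.+1) (sigma : 'rV[R]_n.+1)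
    (sigma_ge0 : forall i : 'I_n.+1, 0 <= sigma 0 i)
    (sigma_noninc : forall i j : 'I_n.+1, (i <= j)%N -> sigma 0 j <= sigma 0 i)
    (e : R) (he : e = defl_e p M U0 V0 sigma) (he1 : e <= 1) :
  (exists (q : nat) (Uq Vq : 'M[R[i]]_(n.+1, q)) (Sq : 'M[R]_q),
      deflation_algorithm sigma e U0 V0 Uq Vq Sq) /\
  (forall (q : nat) (Uq Vq : 'M[R[i]]_(n.+1, q)) (Sq : 'M[R]_q),
      deflation_algorithm sigma e U0 V0 Uq Vq Sq ->
      is_deflation U0 V0 sigma e Uq Vq Sq).
Proof.
(* The sign of [e] makes the test monotone in [kappa]. *)
have e0 : 0 <= e by rewrite he; apply: powR_ge0.
split.
  have [[i k] hk] := outer_loop_term sigma e (0%N, [:: ord0]).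
  by do 4 eexists; exists i, (in_tuple k).
move=> q Uq Vq Sq [i [k [hk -> -> ->]]].
have [gk ni] := outer_loopP sigma_ge0 sigma_noninc e0 he1 hk.
have dk : deflation_list sigma e k.
  by have [kp _ _ _] := gk; apply: deflation_list_pairwise.
split; last by exists k.
split=> [|q' k' dk']; first by exists k.
have := greedy_state_max sigma_ge0 sigma_noninc e0 he1 gk ni dk'.
by rewrite size_tuple.
Qed.
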